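(* Let $d$ be a positive integer and let $\mathfrak m=\langle x_1,\dots,x_n\rangle\subset R=\Bbbk[x_1,\dots,x_n]$. The critical exponents of $\mathfrak m^d$ in the open unit interval $(0,1)$ are in correspondence with the integers $k$ satisfying $n\le k<d$, in the following precise sense. For each integer $k$ with $n\le k<d$, set $s=\inf\{e\ge 1: [kp^e\,\%\,d]<n\}$ (so $s\in\{1,2,\dots\}\cup\{\infty\}$). Then the rational number $$\lambda=\frac{k}{d}-\frac{[kp^s\,\%\,d]}{d\,p^s},$$ where this formula is interpreted as $\lambda=k/d$ if $s=\infty$, is a critical exponent of $\mathfrak m^d$. Moreover, every critical exponent of $\mathfrak m^d$ in the open unit interval $(0,1)$ is of this form for some integer $k$ with $n\le k<d$; and if $p>d$, then $(\mathfrak m^d)^{[\lambda]}=\mathfrak m^{k-n+1}$ for each such $k$ and the corresponding $\lambda$.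
   Context: $p$ is a prime, $\Bbbk$ is a field of characteristic $p$ with $[\Bbbk:\Bbbk^p]<\infty$, $n\ge 1$, and $R=\Bbbk[x_1,\dots,x_n]$. For integers $m$ and $d\ge1$, $[m\,\%\,d]$ denotes the least positive residue of $m$ modulo $d$, i.e. the unique element of $\{1,\dots,d\}$ congruent to $m$ modulo $d$. Frobenius powers. Let $\mathfrak a$ be a nonzero proper ideal of $R$. For an ideal $\mathfrak b$ of $R$ and $e\ge0$, $\mathfrak b^{[p^e]}=\langle f^{p^e}: f\in\mathfrak b\rangle$, and $\mathfrak b^{[1/p^e]}$ is the smallest ideal $\mathfrak c$ with $\mathfrak b\subseteq\mathfrak c^{[p^e]}$. If $m\in\mathbb N$ has base $p$ expansion $m=m_0+m_1p+\cdots+m_rp^r$, then $\mathfrak a^{[m]}=\mathfrak a^{m_0}(\mathfrak a^{m_1})^{[p]}\cdots(\mathfrak a^{m_r})^{[p^r]}$. For $t=m/p^e$ with $m\in\mathbb N$, $\mathfrak a^{[t]}=(\mathfrak a^{[m]})^{[1/p^e]}$. For a real number $t\ge0$, $\mathfrak a^{[t]}=\bigcup_k\mathfrak a^{[t_k]}$, where $(t_k)$ is any sequence of rational numbers whose denominators are powers of $p$ converging to $t$ monotonically from above (the union equals $\mathfrak a^{[t_k]}$ for $k\gg0$). A real number $\lambda>0$ is a critical exponent of $\mathfrak a$ if $\mathfrak a^{[\lambda-\varepsilon]}$ properly contains $\mathfrak a^{[\lambda]}$ for every $0<\varepsilon\le\lambda$. *)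

(* Defs.v *)
From HB Require Import structures.
From mathcomp Require Import all_boot all_order all_algebra.
From mathcomp Require Import mpoly.
From mathcomp Require Import boolp classical_sets reals.

Set Implicit Arguments.
Unset Strict Implicit.
Unset Printing Implicit Defensive.

Import Order.TTheory GRing.Theory Num.Theory.

Local Open Scope classical_set_scope.
Local Open Scope ring_scope.

(* [K : K^p] < oo, for K of characteristic p: finitely many elements span K
   over its subfield of p-th powers. *)
Definition F_finite (p : nat) (K : fieldType) : Prop :=
  exists s : seq K, forall x : K, exists c : 'I_(size s) -> K,
    x = \sum_(i < size s) c i ^+ p * s`_i.

Section Ideals.
Variable A : comNzRingType.
Implicit Types (I J : set A) (S : set A).

Definition is_ideal I : Prop :=
  [/\ I 0, forall f g, I f -> I g -> I (f + g) & forall f g, I g -> I (f * g)].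

Definition ideal_gen S : set A := smallest is_ideal S.

Definition ideal_mul I J : set A := ideal_gen [set f * g | f in I & g in J].

Definition ideal_exp I (m : nat) : set A := iter m (ideal_mul I) setT.

End Ideals.

Section FrobeniusPowers.
Variables (p : nat) (A : comNzRingType).
Implicit Types (a b c : set A).

(* b^[p^e] *)
Definition frob_bracket (e : nat) b : set A :=
  ideal_gen [set f ^+ (p ^ e)%N | f in b].

(* b^[1/p^e]: the smallest ideal, written as the intersection of all the
   candidates; see frob_rootP. *)
Definition frob_root (e : nat) b : set A :=
  \bigcap_(c in [set c | is_ideal c /\ b `<=` frob_bracket e c]) c.

Lemma frob_rootP (e : nat) b c :
    is_ideal c -> b `<=` frob_bracket e c ->
    (forall c', is_ideal c' -> b `<=` frob_bracket e c' -> c `<=` c') ->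
  frob_root e b = c.
Proof.
move=> Ic bc cmin; apply/seteqP; split=> [f rf|f cf c' [Ic' bc']].
  by apply: rf.
exact: cmin cf.
Qed.

(* a^[m]: m %/ p ^ i %% p is the i-th base p digit of m, and the last nonzero
   digit has index trunc_log p m. *)
Definition frob_nat a (m : nat) : set A :=
  \big[@ideal_mul A/setT]_(0 <= i < (trunc_log p m).+1)
     frob_bracket i (ideal_exp a (m %/ p ^ i %% p)%N).

(* a^[m/p^e] *)
Definition frob_frac a (m e : nat) : set A := frob_root e (frob_nat a m).

Section RealExponents.
Variable R : realType.
Implicit Types t : R.

(* The numerator of t_k = ceil (t * p ^ k) / p ^ k; the sequence (t_k)
   converges to t monotonically from above: above_ge, above_nincr, above_cvg. *)
Definition above_num t (k : nat) : nat := `|Num.ceil (t * (p ^ k)%:R)|%N.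

Definition above t (k : nat) : R := (above_num t k)%:R / (p ^ k)%:R.

(* a^[t] for real t >= 0: the union of the a^[t_k]. *)
Definition frob_real a t : set A := \bigcup_k frob_frac a (above_num t k) k.

(* Meaningful for a nonzero proper ideal a. *)
Definition critical_exponent a (l : R) : Prop :=
  0 < l /\
  forall eps : R, 0 < eps -> eps <= l -> frob_real a l `<` frob_real a (l - eps).

Hypothesis p_gt1 : (1 < p)%N.

Let pk_gt0 k : 0 < (p ^ k)%:R :> R.
Proof. by rewrite ltr0n expn_gt0 ltnW. Qed.

Let above_numE t k : 0 <= t ->
  (above_num t k)%:R = (Num.ceil (t * (p ^ k)%:R))%:~R :> R.
Proof.
move=> t0; rewrite pmulrn /above_num gez0_abs //.
by rewrite ceil_ge0 (lt_le_trans (ltrN10 _)) // mulr_ge0 // ltW.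
Qed.

Lemma above_ge t k : 0 <= t -> t <= above t k.
Proof. by move=> t0; rewrite ler_pdivlMr // above_numE // ceil_ge. Qed.

Lemma above_lt t k : 0 <= t -> above t k < t + (p ^ k)%:R^-1.
Proof.
move=> t0; rewrite ltr_pdivrMr // above_numE // mulrDl mulVf ?gt_eqF //.
by rewrite -ltrBlDr -[X in _ - X](mulr1z 1) -intrB; apply: ceilB1_lt.
Qed.

Lemma above_nincr t k : 0 <= t -> above t k.+1 <= above t k.
Proof.
move=> t0; rewrite ler_pdivrMr // above_numE // expnSr natrM mulrA.
have -> : above t k * ((p ^ k)%:R * p%:R) = ((above_num t k) * p)%N%:R.
  by rewrite mulrA divfK ?gt_eqF // natrM.
rewrite [leRHS]pmulrn ler_int ceil_le_int -pmulrn natrM.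
by rewrite ler_wpM2r // above_numE // ceil_ge.
Qed.

Lemma above_cvg t eps : 0 <= t -> 0 < eps ->
  exists N, forall k, (N <= k)%N -> above t k < t + eps.
Proof.
move=> t0 e0; exists (Num.bound eps^-1) => k Nk.
apply: lt_le_trans (above_lt k t0) _; rewrite lerD2l.
rewrite -[leRHS]invrK lef_pV2 ?posrE ?invr_gt0 //.
have ei0 : 0 <= eps^-1 by rewrite invr_ge0 ltW.
apply: le_trans (ltW (archi_boundP ei0)) _; rewrite ler_nat.
by apply: leq_trans Nk (ltnW (ltn_expl _ p_gt1)).
Qed.

End RealExponents.
End FrobeniusPowers.

(* The ideal <x_1, ..., x_n> of K[x_1, ..., x_n]. *)
Definition max_ideal (K : fieldType) (n : nat) : set {mpoly K[n]} :=
  ideal_gen [set f | exists i : 'I_n, f = 'X_i].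
Arguments max_ideal : clear implicits.

(* [m % d], the least positive residue of m modulo d >= 1; only natural
   numbers m are needed. *)
Definition lpr (m d : nat) : nat := if (d %| m)%N then d else (m %% d)%N.

Lemma lprP (m d r : nat) : (0 < d)%N ->
  lpr m d = r <-> (0 < r <= d)%N /\ r = m %[mod d].
Proof.
rewrite /lpr => d0; case: ifPn => [dm|ndm]; split.
- by move=> <-; rewrite d0 leqnn modnn (eqP dm).
- case=> /andP[r0 rd]; rewrite (eqP dm) => /eqP dr.
  by apply/eqP; rewrite eqn_leq rd andbT dvdn_leq.
- by move=> <-; rewrite lt0n modn_mod ltnW ?ltn_mod // andbT.
- case=> /andP[r0]; rewrite leq_eqVlt => /predU1P[->|/modn_small -> //].
  by rewrite modnn => /esym/eqP; rewrite -/(dvdn d m) (negPf ndm).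
Qed.

(* The infimum of a set of natural numbers, None standing for oo = inf {}. *)
Definition inf_nat (P : pred nat) : option nat :=
  if pselect (exists e, P e) is left exP then Some (ex_minn exP) else None.

(* s = inf {e >= 1 : [k p^e % d] < n} *)
Definition crit_s (p n d k : nat) : option nat :=
  inf_nat (fun e => (1 <= e)%N && (lpr (k * p ^ e) d < n)%N).

Definition crit_lambda (R : realType) (p n d k : nat) : R :=
  if crit_s p n d k is Some s
  then k%:R / d%:R - (lpr (k * p ^ s) d)%:R / (d * p ^ s)%N%:R
  else k%:R / d%:R.

(* Main.v *)
Require Import Defs.
From HB Require Import structures.
From mathcomp Require Import all_boot all_order all_algebra.
From mathcomp Require Import mpoly.
From mathcomp Require Import boolp classical_sets reals.
From mathcomp Require Import zify ring.
Import Order.TTheory GRing.Theory Num.Theory.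
Local Open Scope classical_set_scope.
Local Open Scope ring_scope.

Set Implicit Arguments.
Unset Strict Implicit.
Unset Printing Implicit Defensive.

(* All the ideals involved are monomial. Writing out the base p digits of M, a
   monomial x^w lies in (m^d)^[M] iff d floor(M / p^i) <= sum_j floor(w_j / p^i)
   for all i. The root b^[1/q] of a monomial ideal b is spanned by the x^w with
   x^(q w + q - 1) in b, by means of a q^-1-linear splitting of the Frobenius
   map. Hence, for M <= p^e and N = |w| + n, x^w lies in (m^d)^[M / p^e] iff
   d floor(M / p^(e-j)) + n <= p^j N for all j <= e. For 0 <= t < 1, passing to
   the limit, x^w lies in (m^d)^[t] iff d <= N or t < inf_j (c_j + 1) / p^j,
   where c_j = floor((p^j N - n) / d); and for n <= N < d this infimum is the
   number lambda attached to k = N. *)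

(** * Monomial ideals and their Frobenius powers *)

Section Ideals.
Variable A : comNzRingType.
Implicit Types I J S : set A.

Lemma ideal_gen_ideal S : is_ideal (ideal_gen S).
Proof.
split=> [I [[]] //|f g If Ig I [II SI]|f g Ig I [II SI]].
  by case: (II) => _ addI _; apply: addI; [apply: If|apply: Ig].
by case: (II) => _ _ mulI; apply: mulI; apply: Ig.
Qed.

Lemma sub_ideal_gen S : S `<=` ideal_gen S.
Proof. by move=> f Sf I [_]; apply. Qed.

Lemma ideal_gen_sub S I : is_ideal I -> S `<=` I -> ideal_gen S `<=` I.
Proof. by move=> II SI f; apply. Qed.

Lemma ideal_sum I (T : eqType) (r : seq T) (F : T -> A) :
  is_ideal I -> (forall i, i \in r -> I (F i)) -> I (\sum_(i <- r) F i).
Proof.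
by case=> I0 addI _ IF; rewrite big_seq; elim/big_ind: _.
Qed.

End Ideals.

Section MonomialIdeals.
Variables (K : fieldType) (n : nat).
Implicit Types (P Q : set 'X_{1..n}) (I : set {mpoly K[n]}).

Definition mnm_upset P := forall u v, (u <= v)%MM -> P u -> P v.

(** Membership is tested on the support, so the definition makes sense for any [P]; it is an ideal
    as soon as [P] is closed under passing to multiples. *)
Definition mon_ideal P : set {mpoly K[n]} :=
  [set f | forall w, w \in msupp f -> P w].

Lemma mon_idealX P w : mon_ideal P 'X_[w] <-> P w.
Proof.
by split=> [|Pw u]; [apply; rewrite msuppX inE|rewrite msuppX inE => /eqP ->].
Qed.

Lemma mon_ideal_ideal P : mnm_upset P -> is_ideal (mon_ideal P).
Proof.
move=> upP; split=> [w|f g If Ig w /msuppD_le|f g Ig w /msuppM_le].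
- by rewrite msupp0.
- by rewrite mem_cat => /orP[]; [apply: If|apply: Ig].
- case/allpairsP=> -[u v] /= [_ gv ->]; apply: upP (Ig _ gv); exact: lem_addl.
Qed.

Lemma mon_ideal_sub P I : is_ideal I ->
  (forall w, P w -> I 'X_[w]) -> mon_ideal P `<=` I.
Proof.
move=> II IX f Pf; rewrite (mpolyE f); apply: ideal_sum => // w fw.
by rewrite -mul_mpolyC; case: II => _ _; apply; apply/IX/Pf.
Qed.

Lemma mon_ideal_eq P Q : (forall w, P w <-> Q w) -> mon_ideal P = mon_ideal Q.
Proof. by move=> PQ; congr mon_ideal; apply/funext => w; apply/propext. Qed.

Lemma max_idealE : max_ideal K n = mon_ideal [set w | (0 < mdeg w)%N].
Proof.
have up : mnm_upset [set w | (0 < mdeg w)%N].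
  by move=> u v /submK <- /=; rewrite mdegD; lia.
apply/seteqP; split.
  apply: ideal_gen_sub (mon_ideal_ideal up) _ => _ [i ->].
  by apply/mon_idealX; rewrite /= mdeg1.
apply: mon_ideal_sub (ideal_gen_ideal _) _ => w /=.
rewrite lt0n mdeg_eq0 => w0.
have [i wi] : exists i, w i != 0%N.
  apply/existsP; apply: contraR w0; rewrite negb_exists => /forallP w0.
  by apply/eqP/mnmP => i; rewrite mnm0E; apply/eqP; rewrite -[_ == _]negbK w0.
have /submK <- : (U_(i) <= w)%MM by rewrite lep1mP.
rewrite mpolyXD; case: (ideal_gen_ideal [set f | exists i : 'I_n, f = 'X_i :> {mpoly K[n]}]).
by move=> _ _; apply; apply: sub_ideal_gen; exists i.
Qed.

Definition mnm_setD P Q : set 'X_{1..n} :=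
  [set w | exists u v, [/\ P u, Q v & w = (u + v)%MM]].

Lemma mon_ideal_mul P Q : mnm_upset P -> mnm_upset Q ->
  ideal_mul (mon_ideal P) (mon_ideal Q) = mon_ideal (mnm_setD P Q).
Proof.
move=> upP upQ; apply/seteqP; split.
  apply: ideal_gen_sub; first apply: mon_ideal_ideal.
    move=> u v uv [u1 [u2 [Pu1 Qu2 du]]]; exists u1, (v - u + u2)%MM; split=> //.
      by apply: upQ Qu2; apply: lem_addl.
    by rewrite -{1}(submK uv) {2}du !addmA [(u1 + _)%MM]addmC.
  move=> _ [f Pf [g Qg <-]] w /msuppM_le /allpairsP[[u v] /= [fu gv ->]].
  by exists u, v; split; [apply: Pf|apply: Qg|].
apply: mon_ideal_sub (ideal_gen_ideal _) _ => _ [u [v [Pu Qv ->]]].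
apply: sub_ideal_gen; exists 'X_[u]; first exact/mon_idealX.
by exists 'X_[v]; [exact/mon_idealX|rewrite mpolyXD].
Qed.

Lemma mnm_upset_deg m : mnm_upset [set w | (m <= mdeg w)%N].
Proof. by move=> u v /submK <- /=; rewrite mdegD; lia. Qed.

(** Discrete intermediate values: starting from [u], one exponent still below that of [w] is raised
    by one at a time. *)
Lemma mnm_interp (u w : 'X_{1..n}) m : (u <= w)%MM ->
  (mdeg u <= m)%N -> (m <= mdeg w)%N ->
  exists v, [/\ (u <= v)%MM, (v <= w)%MM & mdeg v = m].
Proof.
move=> uw; elim: m => [|m IHm] um mw.
  by exists u; split; [apply: lepm_refl| |apply/eqP; rewrite -leqn0].
move: um; rewrite leq_eqVlt ltnS => /predU1P[um|/IHm[|v [uv vw vm]]].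
- by exists u; split=> //; apply: lepm_refl.
- exact: ltnW.
have /existsP[i vi] : [exists i, v i < w i]%N.
  apply: contraLR mw; rewrite negb_exists -ltnNge => /forallP wv.
  rewrite ltnS -vm !mdegE; apply: leq_sum => i _; have := wv i; lia.
exists (v + U_(i))%MM; split.
- by apply: lepm_trans uv _; apply: lem_addr.
- apply/mnm_lepP => j; rewrite mnmDE mnm1E; have := mnm_lepP vw j.
  by case: eqP => [<-|_]; lia.
- by rewrite mdegD mdeg1 vm addn1.
Qed.

Lemma mon_ideal_deg_exp d m :
  ideal_exp (mon_ideal [set w | (d <= mdeg w)%N]) m =
  mon_ideal [set w | (d * m <= mdeg w)%N].
Proof.
elim: m => [|m IHm].
  by apply/seteqP; split=> // f _ w _ /=; rewrite muln0.
rewrite /ideal_exp iterS -/(ideal_exp _ m) IHm mon_ideal_mul;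
  try exact: mnm_upset_deg.
apply: mon_ideal_eq => w; split=> [[u [v /= [du dv ->]]]|/= dw].
  by rewrite mdegD mulnS leq_add.
(* A divisor of degree exactly [d * m] leaves a cofactor of degree at least [d]. *)
have [|||v [_ vw vd]] := @mnm_interp 0%MM w (d * m).
- by apply/mnm_lepP => i; rewrite mnm0E.
- by rewrite mdeg0.
- by apply: leq_trans dw; rewrite leq_mul.
exists (w - v)%MM, v; split=> /=; [|by rewrite vd|by rewrite submK].
by move: dw; rewrite -{1}(submK vw) mdegD vd mulnS; lia.
Qed.

Lemma expr_sum_pchar (A : comNzRingType) p e (T : Type) (r : seq T) (F : T -> A) :
  p \in [pchar A] ->
  (\sum_(i <- r) F i) ^+ (p ^ e)%N = \sum_(i <- r) F i ^+ (p ^ e)%N.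
Proof.
move=> charA; have pcharpe : [pchar A].-nat (p ^ e)%N.
  by rewrite pnatX pnatE ?charA // (pcharf_prime charA).
elim/big_rec2: _ => [|i x y _ <-]; last by rewrite exprDn_pchar.
by rewrite expr0n expn_eq0; case: p charA {pcharpe} => // /pcharf_prime.
Qed.

Lemma mpoly_exprX p e f : p \in [pchar K] ->
  f ^+ (p ^ e)%N = \sum_(w <- msupp f)
     (f@_w ^+ (p ^ e)%N *: 'X_[w *+ (p ^ e)%N]) :> {mpoly K[n]}.
Proof.
move=> charK; rewrite {1}(mpolyE f) expr_sum_pchar.
  by apply: eq_bigr => w _; rewrite exprZn mpolyXn.
exact: rmorph_pchar (@mpolyC n K) _ charK.
Qed.

(** Frobenius is additive in characteristic [p], so [f ^+ (p ^ e)] involves only the [p ^ e]-th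
    powers of the monomials of [f]. *)
Lemma mon_ideal_bracket p e P :
  p \in [pchar K] -> mnm_upset P ->
  frob_bracket p e (mon_ideal P) =
  mon_ideal [set w | exists2 u, P u & (u *+ (p ^ e)%N <= w)%MM].
Proof.
move=> charK upP.
have up : mnm_upset [set w | exists2 u, P u & (u *+ (p ^ e)%N <= w)%MM].
  by move=> u v uv [w Pw wu]; exists w => //; apply: lepm_trans wu uv.
apply/seteqP; split.
  apply: ideal_gen_sub (mon_ideal_ideal up) _ => _ [f Pf <-].
  rewrite (mpoly_exprX _ _ charK); apply: ideal_sum (mon_ideal_ideal up) _ => w fw.
  rewrite -mul_mpolyC; case: (mon_ideal_ideal up) => _ _; apply.
  by apply/mon_idealX; exists w; [apply: Pf|apply: lepm_refl].
apply: mon_ideal_sub (ideal_gen_ideal _) _ => w [u Pu /submK <-].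
rewrite mpolyXD -mpolyXn; case: (ideal_gen_ideal [set f ^+ (p ^ e)%N | f in mon_ideal P]).
move=> _ _; apply; apply: sub_ideal_gen; exists 'X_[u] => //; exact/mon_idealX.
Qed.

(** * Integral Frobenius powers and base [p] digits *)

Definition mnm_div (w : 'X_{1..n}) q := [multinom (w i %/ q)%N | i < n].

Lemma mnm_divE w q i : mnm_div w q i = (w i %/ q)%N.
Proof. exact: mnmE. Qed.

Definition digit_cond d p m : set 'X_{1..n} :=
  [set w | forall i, (d * (m %/ p ^ i) <= mdeg (mnm_div w (p ^ i)))%N].

Lemma mnm_div_mono u w q : (u <= w)%MM -> (mdeg (mnm_div u q) <= mdeg (mnm_div w q))%N.
Proof.
move=> uw; rewrite !mdegE; apply: leq_sum => i _; rewrite !mnm_divE.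
exact/leq_div2r/mnm_lepP.
Qed.

Lemma mnm_div_div w q r : mnm_div (mnm_div w q) r = mnm_div w (q * r)%N.
Proof. by apply/mnmP => i; rewrite !mnm_divE divnMA. Qed.

Lemma mnm_divw1 w : mnm_div w 1 = w.
Proof. by apply/mnmP => i; rewrite mnm_divE divn1. Qed.

Lemma digit_cond_up d p m : mnm_upset (digit_cond d p m).
Proof. by move=> u v uv cu i; apply: leq_trans (cu i) (mnm_div_mono _ uv). Qed.

(** Nested floors compose, so the scales [i >= 1] form the same condition for the quotients by [p];
    inductions on digits rest on this. *)
Lemma digit_condS d p m w : digit_cond d p m w <->
  (d * m <= mdeg w)%N /\ digit_cond d p (m %/ p) (mnm_div w p).
Proof.
split=> [cw|[c0 cw] [|i]].
- split; first by have := cw 0; rewrite expn0 divn1 mnm_divw1.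
  by move=> i; rewrite mnm_div_div -divnMA -expnS.
- by rewrite expn0 divn1 mnm_divw1.
- by rewrite expnS divnMA -mnm_div_div.
Qed.

Lemma mdeg_div_mul w q : (mdeg (mnm_div w q) * q <= mdeg w)%N.
Proof.
rewrite !mdegE big_distrl; apply: leq_sum => i _; rewrite mnm_divE.
exact: leq_divM.
Qed.

(* A packing argument: [d * m_i] packets of size [p ^ i] are put into bins of
   capacities [w i]. As the sizes divide each other, storing the large packets
   first shows that the volume bounds at all scales suffice. *)
Lemma digit_cond_min d p m w : (1 < p)%N -> digit_cond d p m w ->
  exists v, [/\ (v <= w)%MM, mdeg v = (d * m)%N & digit_cond d p m v].
Proof.
move=> p1; elim/ltn_ind: m w => m IHm w; case: (posnP m) => [->|m0] cw.
  exists 0%MM; split; first by apply/mnm_lepP => i; rewrite mnm0E.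
    by rewrite mdeg0 muln0.
  by move=> i; rewrite div0n muln0.
have [c0 /IHm[|v [vw dv cv]]] := (digit_condS d p m w).1 cw.
  exact: ltn_Pdiv.
(* [v] packs the large packets, and [v *+ p] has degree [d * (m %/ p) * p]. Filling up to degree
   [d * m] keeps the higher scales valid, since [v] still lies below the quotient of [u] by [p]. *)
have [|||u [vu uw du]] := @mnm_interp (v *+ p)%MM w (d * m).
- apply/mnm_lepP => i; rewrite mulmnE; have := mnm_lepP vw i.
  by rewrite mnm_divE => vi; apply: leq_trans (leq_divM (w i) p); rewrite leq_mul2r vi orbT.
- by rewrite mdegMn dv -mulnA leq_mul2l leq_divM orbT.
- exact: c0.
exists u; split=> //; apply/digit_condS; split; first by rewrite du.
apply: digit_cond_up cv; apply/mnm_lepP => i.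
rewrite mnm_divE leq_divRL ?(ltnW p1) // -mulmnE. exact: (mnm_lepP vu).
Qed.

(** Induction on the number [L] of digits left, splitting off the lowest one. Floors are
    superadditive, which gives one inclusion; the other needs a factor for the higher digits that is
    as small as possible. *)
Lemma mon_ideal_frob_nat_aux d p m L j : p \in [pchar K] -> (m < p ^ (j + L))%N ->
  \big[@ideal_mul {mpoly K[n]}/setT]_(j <= i < j + L)
     frob_bracket p i (mon_ideal [set w | (d * (m %/ p ^ i %% p) <= mdeg w)%N]) =
  mon_ideal [set w | digit_cond d p (m %/ p ^ j) (mnm_div w (p ^ j))].
Proof.
move=> charK; have p0 : (0 < p)%N := prime_gt0 (pcharf_prime charK).
have p1 : (1 < p)%N := prime_gt1 (pcharf_prime charK).
have up i : mnm_upset [set w | digit_cond d p (m %/ p ^ i) (mnm_div w (p ^ i))].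
  move=> u v uv; apply: digit_cond_up; apply/mnm_lepP => k; rewrite !mnm_divE.
  exact/leq_div2r/mnm_lepP.
elim: L j => [|L IHL] j mL.
  rewrite addn0 in mL *; rewrite big_geq //; apply/seteqP; split=> // f _ w _ i /=.
  by rewrite (divn_small mL) div0n muln0.
rewrite big_ltn -?addSnnS ?leq_addr // IHL ?addSnnS //.
rewrite mon_ideal_bracket //; last exact: mnm_upset_deg.
rewrite mon_ideal_mul //; last first.
  by move=> u v uv [w Pw wu]; exists w => //; apply: lepm_trans wu uv.
apply: mon_ideal_eq => w; split.
  move=> [u [v [[a /= da au] /= cv ->]]]; apply/digit_condS; split; last first.
    rewrite mnm_div_div -divnMA -expnSr.
    by apply: (up j.+1) cv; apply: lem_addl.
  rewrite {1}(divn_eq (m %/ p ^ j) p) addnC mulnDr -divnMA -expnSr.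
  have [cv0 _] := (digit_condS d p _ _).1 cv.
  have cv1 := mdeg_div_mul (mnm_div v (p ^ j)) p.
  rewrite mnm_div_div -expnSr in cv1.
  apply: leq_trans (leq_add da (leq_trans _ cv1)) _.
    by rewrite mulnA leq_mul2r cv0 orbT.
  rewrite -mdegD; rewrite !mdegE; apply: leq_sum => i _.
  rewrite mnmDE !mnm_divE mnmDE leq_divRL ?expn_gt0 ?p0 // mulnDl.
  by rewrite leq_add ?leq_divM // -mulmnE; apply: (mnm_lepP au).
case/(digit_condS d p _ _).1; rewrite mnm_div_div -divnMA -expnSr => c0.
case/(digit_cond_min p1) => v [vw dv cv].
have vw' : (v *+ p <= mnm_div w (p ^ j))%MM.
  apply/mnm_lepP => i; rewrite mulmnE mnm_divE leq_divRL ?expn_gt0 ?p0 //.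
  by rewrite -mulnA -expnS -leq_divRL ?expn_gt0 ?p0 // -mnm_divE; apply/mnm_lepP.
have vw2 : (v *+ (p ^ j.+1) <= w)%MM.
  apply/mnm_lepP => i; rewrite mulmnE -leq_divRL ?expn_gt0 ?p0 // -mnm_divE.
  exact/mnm_lepP.
(* The higher digits use exactly [d * (m %/ p ^ j.+1) * p] units of size [p ^ j], so by [c0] what
   remains suffices for digit [j]. *)
exists (w - v *+ (p ^ j.+1))%MM, (v *+ (p ^ j.+1))%MM; split; last by rewrite submK.
- exists (mnm_div w (p ^ j) - v *+ p)%MM => /=.
    move: c0; rewrite -{1}(submK vw') mdegD mdegMn dv.
    rewrite [in X in (X <= _)%N](divn_eq (m %/ p ^ j) p) -divnMA -expnSr mulnDr.
    by rewrite mulnA addnC leq_add2r.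
  apply/mnm_lepP => i; rewrite mulmnE !mnmBE !mulmnE mnm_divE mulnBl expnS mulnA.
  by apply: leq_sub2r; apply: leq_divM.
- rewrite /=; apply: digit_cond_up cv; apply/mnm_lepP => i.
  by rewrite mnm_divE mulmnE mulnK ?expn_gt0 ?p0.
Qed.

Lemma mon_ideal_frob_nat d p m : p \in [pchar K] ->
  frob_nat p (mon_ideal [set w | (d <= mdeg w)%N]) m = mon_ideal (digit_cond d p m).
Proof.
move=> charK; rewrite /frob_nat.
under eq_bigr => i _ do rewrite mon_ideal_deg_exp.
rewrite -[(trunc_log p m).+1]add0n mon_ideal_frob_nat_aux //.
  by apply: mon_ideal_eq => w /=; rewrite expn0 divn1 mnm_divw1.
by rewrite add0n trunc_log_ltn ?prime_gt1 ?(pcharf_prime charK).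
Qed.
End MonomialIdeals.
Arguments mon_ideal K {n} P _.

(** * Frobenius roots of monomial ideals *)

(* [K] with scalars acting through the Frobenius map is finite-dimensional, and
   [theta] is the coordinate of a basis containing [1]. A spanning family of
   the form [1, s_0, ..., s_(m-1)] with [m] minimal is such a basis. *)
Lemma F_finite_proj p (K : fieldType) : p \in [pchar K] -> F_finite p K ->
  exists theta : K -> K, [/\ {morph theta : a b / a + b},
    forall a b, theta (a ^+ p * b) = a * theta b & theta 1 = 1].
Proof.
move=> charK [s0 span0]; pose F : {rmorphism K -> K} := pFrobenius_aut charK.
have FE a : a ^+ p = F a by [].
pose dec m (s : 'I_m -> K) x a c := x = F a + \sum_(i < m) F (c i) * s i.
pose spans m := exists s : 'I_m -> K, forall x, exists a c, dec m s x a c.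
have exS : exists m, `[< spans m >].
  exists (size s0); apply/asboolP; exists (fun i => s0`_i) => x.
  by have [c ->] := span0 x; exists 0, c; rewrite /dec rmorph0 add0r.
case: (ex_minnP exS) => m /asboolP[s spans_s] min_m.
have indep a c : dec m s 0 a c -> a = 0.
  move=> dc; have [/existsP[j cj]|] := boolP [exists j, c j != 0]; last first.
    rewrite negb_exists => /forallP c0; apply/eqP; rewrite -(fmorph_eq0 F) eq_sym.
    apply/eqP; rewrite dc big1 ?addr0 // => i _.
    by have /negPn/eqP -> := c0 i; rewrite rmorph0 mul0r.
  (* A nonzero [c j] allows [s j] to be eliminated, contradicting the minimality of the spanning
     family. *)
  case: m => [|m] in s spans_s min_m c dc j cj *; first by case: j {cj}.
  have /min_m : `[< spans m >]; last by rewrite ltnn.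
  apply/asboolP; exists (fun i => s (lift j i)) => x.
  have [b [e ->]] := spans_s x.
  exists (b - e j / c j * a), (fun i => e (lift j i) - e j / c j * c (lift j i)).
  rewrite /dec !(bigD1_ord j) //= in dc *.
  have Fcj : F (c j) != 0 by rewrite fmorph_eq0.
  have -> : s j = - ((F (c j))^-1 *
      (F a + \sum_(i < m) F (c (lift j i)) * s (lift j i))).
    apply: (mulfI Fcj); rewrite mulrN mulVKf //; apply/eqP.
    by rewrite -addr_eq0 addrCA -dc.
  under [in RHS]eq_bigr => i _ do rewrite rmorphB rmorphM mulrBl -mulrA.
  rewrite sumrB -mulr_sumr !rmorphB !rmorphM fmorphV; ring.
have [theta thetaP] := boolp.choice spans_s.
have uniq x a c : dec m s x a c -> theta x = a.
  move=> dx; have [c' dx'] := thetaP x; apply/subr0_eq.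
  apply: (indep _ (fun i => c' i - c i)); rewrite /dec.
  under eq_bigr => i _ do rewrite rmorphB mulrBl.
  by rewrite sumrB rmorphB addrACA -opprD -dx -dx' subrr.
exists theta; split=> [x y|a x|].
- have [c dx] := thetaP x; have [e dy] := thetaP y.
  apply: (uniq _ _ (fun i => c i + e i)); rewrite /dec.
  under eq_bigr => i _ do rewrite rmorphD mulrDl.
  by rewrite big_split rmorphD addrACA -dx -dy.
- have [c dx] := thetaP x; apply: (uniq _ _ (fun i => a * c i)); rewrite /dec FE.
  under eq_bigr => i _ do rewrite rmorphM -mulrA.
  by rewrite -mulr_sumr rmorphM -mulrDr -dx.
- apply: (uniq _ _ (fun=> 0)); rewrite /dec rmorph1.
  by rewrite big1 ?addr0 // => i _; rewrite rmorph0 mul0r.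
Qed.

Lemma F_finite_projX p e (K : fieldType) : p \in [pchar K] -> F_finite p K ->
  exists theta : K -> K, [/\ {morph theta : a b / a + b},
    forall a b, theta (a ^+ (p ^ e)%N * b) = a * theta b & theta 1 = 1].
Proof.
move=> charK finK; have [theta [thD thM th1]] := F_finite_proj charK finK.
elim: e => [|e [eta [etD etM et1]]].
  by exists id; split=> // a b; rewrite expn0 expr1.
exists (eta \o theta); split=> [a b|a b|] /=; rewrite ?thD ?th1 //.
by rewrite expnSr exprM thM etM.
Qed.

Section FrobRoot.
Variables (K : fieldType) (n : nat).

(* The largest monomial whose exponents have quotients [w i] modulo [q]. *)
Definition mnm_top (w : 'X_{1..n}) q := [multinom (w i * q + q.-1)%N | i < n].

Lemma mnm_topE w q i : mnm_top w q i = (w i * q + q.-1)%N.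
Proof. exact: mnmE. Qed.

Lemma mnm_topD w u q : mnm_top (w + u) q = (mnm_top w q + u *+ q)%MM.
Proof.
by apply/mnmP => i; rewrite mnmDE mulmnE !mnm_topE mnmDE mulnDl addnAC.
Qed.

Lemma mnm_lep_top w u q : (0 < q)%N -> (u *+ q <= mnm_top w q)%MM = (u <= w)%MM.
Proof.
move=> q0; apply/mnm_lepP/mnm_lepP => uw i; have := uw i;
  rewrite mulmnE mnm_topE; move: q0; clear; nia.
Qed.

Variables (q : nat) (theta : K -> K).
Hypothesis q_gt0 : (0 < q)%N.
Hypothesis thetaD : {morph theta : a b / a + b}.
Hypothesis thetaM : forall a b, theta (a ^+ q * b) = a * theta b.

Let theta0 : theta 0 = 0.
Proof. by apply: (addrI (theta 0)); rewrite -thetaD !addr0. Qed.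

(* If [theta] is [q^-1]-linear and [theta 1 = 1], then [frob_trace] is also
   [q^-1]-linear and maps [f ^+ q * 'X_[q-1, ..., q-1]] to [f]. *)
Definition frob_trace (f : {mpoly K[n]}) : {mpoly K[n]} :=
  \sum_(w : 'X_{1..n < msize f}) theta f@_(mnm_top w q) *: 'X_[w].

Lemma mcoeff_frob_trace f w : (frob_trace f)@_w = theta f@_(mnm_top w q).
Proof.
have [wf|fw] := ltnP (mdeg w) (msize f).
  by rewrite (mcoeff_mpoly (fun w => theta f@_(mnm_top w q)) wf).
(* Truncating the sum loses nothing: [mnm_top w q] has degree at least that of [w], hence lies
   outside the support. *)
rewrite (memN_msupp_eq0 (m := mnm_top w q)); last first.
  apply: msize_mdeg_ge; apply: leq_trans fw _; rewrite !mdegE.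
  by apply: leq_sum => i _; rewrite mnm_topE; move: q_gt0; clear; nia.
rewrite theta0 raddf_sum big1 // => -[v /= vf] _.
rewrite mcoeffZ mcoeffX; case: eqP => [vw|]; last by rewrite mulr0.
by rewrite vw ltnNge fw in vf.
Qed.

Lemma frob_traceD : {morph frob_trace : f g / f + g}.
Proof.
move=> f g; apply/mpolyP => w.
by rewrite mcoeffD !mcoeff_frob_trace mcoeffD thetaD.
Qed.

Lemma frob_trace0 : frob_trace 0 = 0.
Proof. by apply: (addrI (frob_trace 0)); rewrite -frob_traceD !addr0. Qed.

Lemma frob_traceMX (g : {mpoly K[n]}) a u :
  frob_trace (a ^+ q *: (g * 'X_[u *+ q])) = a *: (frob_trace g * 'X_[u]).
Proof.
apply/mpolyP => w; rewrite mcoeff_frob_trace !mcoeffZ thetaM; congr (a * _).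
have [/submK <-|uw] := boolP (u <= w)%MM.
  by rewrite mnm_topD ![(_ + u *+ _)%MM]addmC ![(_ + u)%MM]addmC !mcoeffMX mcoeff_frob_trace.
have coef0 (h : {mpoly K[n]}) v v' : ~~ (v <= v')%MM -> (h * 'X_[v])@_v' = 0.
  move=> vv'; apply: memN_msupp_eq0; rewrite (perm_mem (msuppMX _ _)).
  by apply: contra vv' => /mapP[v2 _ ->]; apply: lem_addr.
by rewrite !coef0 // mnm_lep_top.
Qed.

Lemma frob_traceX w : theta 1 = 1 -> frob_trace 'X_[mnm_top w q] = 'X_[w].
Proof.
move=> theta1; apply/mpolyP => v; rewrite mcoeff_frob_trace !mcoeffX.
have -> : (mnm_top w q == mnm_top v q) = (w == v).
  apply/eqP/eqP => [/mnmP wv|-> //]; apply/mnmP => i; have := wv i.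
  by rewrite !mnm_topE; move: q_gt0; clear; nia.
by case: (w == v).
Qed.

End FrobRoot.

Lemma mon_ideal_frob_root (K : fieldType) n p e (P : set 'X_{1..n}) :
  p \in [pchar K] -> F_finite p K -> mnm_upset P ->
  frob_root p e (mon_ideal K P) = mon_ideal K [set w | P (mnm_top w (p ^ e))].
Proof.
move=> charK finK upP.
have q0 : (0 < p ^ e)%N by rewrite expn_gt0 prime_gt0 ?(pcharf_prime charK).
have upP' : mnm_upset [set w | P (mnm_top w (p ^ e))].
  move=> u v uv; apply: upP; apply/mnm_lepP => i; rewrite !mnm_topE leq_add2r.
  by rewrite leq_mul2r (mnm_lepP uv) orbT.
apply: frob_rootP; first exact: mon_ideal_ideal.
  (* [mnm_top] of the quotient of [w] is the largest exponent with the same quotients, so it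
     dominates [w] and lies in [P]. *)
  rewrite mon_ideal_bracket // => f Pf w /Pf Pw; exists (mnm_div w (p ^ e)) => /=.
    apply: upP Pw; apply/mnm_lepP => i; rewrite mnm_topE mnm_divE.
    by rewrite {1}(divn_eq (w i) (p ^ e)) leq_add2l -ltnS prednK // ltn_mod.
  by apply/mnm_lepP => i; rewrite mulmnE mnm_divE leq_divM.
move=> c' Ic' Pc'; apply: mon_ideal_sub => // w Pw.
have [theta [thD thM th1]] := F_finite_projX e charK finK.
have [c'0 c'D c'M] := Ic'.
have tr0 := @frob_trace0 K n (p ^ e) theta q0 thD.
have trD := @frob_traceD K n (p ^ e) theta q0 thD.
(* The largest ideal that the trace maps into [c']. It contains the bracket power of [c'], hence
   each ['X_[mnm_top w (p ^ e)]] in the given ideal, whose trace is ['X_[w]]. *)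
pose J := [set f | forall g, c' (frob_trace (p ^ e) theta (g * f))].
have IJ : is_ideal J.
  split=> [g|f g Jf Jg h|f g Jg h]; first by rewrite mulr0 tr0.
    by rewrite mulrDr trD; apply: c'D.
  by rewrite mulrA.
suff brJ : frob_bracket p e c' `<=` J.
  have := brJ _ (Pc' _ ((mon_idealX K P _).2 Pw)) 1.
  by rewrite mul1r (@frob_traceX K n _ theta q0 thD).
apply: ideal_gen_sub => // _ [f c'f <-] g.
rewrite (mpoly_exprX _ _ charK) mulr_sumr (big_morph _ trD tr0).
under eq_bigr => u _ do rewrite -scalerAr frob_traceMX // scalerAr.
by rewrite -mulr_sumr -mpolyE; apply: c'M.
Qed.

(** * The threshold attached to a degree *)

Lemma mon_ideal_frob_frac (K : fieldType) n d p m e :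
  p \in [pchar K] -> F_finite p K -> (m <= p ^ e)%N ->
  frob_frac p (mon_ideal K [set w : 'X_{1..n} | (d <= mdeg w)%N]) m e =
  mon_ideal K [set w : 'X_{1..n} | forall j, (j <= e)%N ->
     (d * (m %/ p ^ (e - j)) + n <= p ^ j * (mdeg w + n))%N].
Proof.
move=> charK finK mpe; have p1 : (1 < p)%N := prime_gt1 (pcharf_prime charK).
have p_gt0 i : (0 < p ^ i)%N by rewrite expn_gt0 ltnW.
rewrite /frob_frac mon_ideal_frob_nat // mon_ideal_frob_root //; last first.
  exact: digit_cond_up.
(* Adding 1 to each exponent makes the floors exact: [w k * p ^ e + p ^ e - 1] has quotient
   [(w k + 1) * p ^ (e - i) - 1] by [p ^ i]. Summing over the variables produces the shift by
   [n]. *)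
have degE i (w : 'X_{1..n}) : (i <= e)%N ->
    (mdeg (mnm_div (mnm_top w (p ^ e)) (p ^ i)) + n = p ^ (e - i) * (mdeg w + n))%N.
  move=> ie; rewrite !mdegE.
  have nE : n = (\sum_(k < n) 1)%N by rewrite sum1_card card_ord.
  rewrite [X in (_ + X)%N = _]nE [X in _ = (_ * (_ + X))%N]nE -!big_split /= big_distrr.
  apply: eq_bigr => k _; rewrite mnm_divE mnm_topE.
  have -> : (p ^ e = p ^ (e - i) * p ^ i)%N by rewrite -expnD subnK.
  have -> : (w k * (p ^ (e - i) * p ^ i) + (p ^ (e - i) * p ^ i).-1 =
      (w k * p ^ (e - i) + (p ^ (e - i)).-1) * p ^ i + (p ^ i).-1)%N.
    move: (p ^ (e - i))%N (p ^ i)%N (p_gt0 (e - i)%N) (p_gt0 i) => [//|a] [//|b] _ _.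
    by rewrite mulnDl mulnA -addnA mulSn addSn /= [(b + _)%N]addnC.
  rewrite divnMDl // [((p ^ i).-1 %/ _)%N]divn_small ?prednK // addn0.
  by rewrite -addnA addn1 prednK // [RHS]mulnDr muln1 mulnC.
apply: mon_ideal_eq => w; split=> cw.
  by move=> j je; rewrite -{2}(subKn je) -degE ?leq_subr // leq_add2r; apply: cw.
(* Scales beyond [e] impose nothing, because [m <= p ^ e < p ^ i]. *)
move=> i; have [ie|ei] := leqP i e; last first.
  by rewrite divn_small ?muln0 // (leq_ltn_trans mpe) // ltn_exp2l.
have := cw (e - i)%N (leq_subr _ _).
by rewrite subKn // -degE // leq_add2r.
Qed.

Section RealThreshold.
Variables (R : realType) (p n d : nat).
Hypothesis p_gt1 : (1 < p)%N.
Hypothesis n_gt0 : (0 < n)%N.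
Hypothesis d_gt0 : (0 < d)%N.
Implicit Types (t : R) (N : nat).

Let p_gt0 i : (0 < p ^ i)%N. Proof. by rewrite expn_gt0 ltnW. Qed.
Let pR_gt0 i : 0 < (p ^ i)%:R :> R. Proof. by rewrite ltr0n. Qed.
Let dR_gt0 : 0 < d%:R :> R. Proof. by rewrite ltr0n. Qed.

(** For [t < 1] and [N = mdeg w + n], this says that [x^w] lies in some ideal of the union defining
    the power with exponent [t]. *)
Definition below_threshold t N := exists k, forall j, (j <= k)%N ->
  (d * (above_num p t k %/ p ^ (k - j)) + n <= p ^ j * N)%N.

Lemma inf_natP (P : pred nat) :
  if inf_nat P is Some s then P s /\ (forall e, P e -> (s <= e)%N)
  else forall e, ~~ P e.
Proof.
rewrite /inf_nat; case: pselect => [exP|nP].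
  by case: ex_minnP => s Ps smin; split.
by move=> e; apply/negP => Pe; apply: nP; exists e.
Qed.

Lemma lpr_divn_eq m : (0 < m)%N ->
  exists q, m = (q * d + lpr m d)%N /\ (0 < lpr m d <= d)%N.
Proof.
move=> m0; have [/(_ erefl)[lb _] _] := lprP m (lpr m d) d_gt0.
move: lb; rewrite /lpr; case: ifPn => [/dvdnP[q mE]|_] lb.
  (* When [d] divides [m] the residue is [d], not 0, so the quotient drops by one. *)
  exists q.-1; split=> //; rewrite mE in m0 *.
  by case: q m0 {mE} => //= q _; rewrite mulSn addnC.
by exists (m %/ d)%N; rewrite -divn_eq.
Qed.

(* With [q] the quotient in [N p^s = q d + lpr (N p^s) d], the rational number
   [N / d - lpr (N p^s) d / (d p^s)] is [q / p^s]. *)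
Lemma crit_lambda_spec N : (0 < N)%N ->
  (crit_lambda R p n d N = N%:R / d%:R /\
     forall j, (0 < j)%N -> (n <= lpr (N * p ^ j) d)%N) \/
  exists s q, [/\ crit_lambda R p n d N = q%:R / (p ^ s)%:R, (0 < s)%N,
     (q * d < N * p ^ s < q * d + n)%N &
     forall j, (0 < j)%N -> (lpr (N * p ^ j) d < n)%N -> (s <= j)%N].
Proof.
move=> N0; rewrite /crit_lambda /crit_s.
have := inf_natP (fun e => (1 <= e)%N && (lpr (N * p ^ e) d < n)%N).
case: (inf_nat _) => [s [/andP[s0 ls] smin]|noe]; [right|left]; last first.
  by split=> // j j0; have := noe j; rewrite j0 /= -leqNgt.
have [|q [Nq /andP[l0 ld]]] := @lpr_divn_eq (N * p ^ s); first by rewrite muln_gt0 N0 p_gt0.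
exists s, q; split=> //; last by move=> j j0 lj; apply: smin; rewrite j0.
  move: Nq ls l0; set l := lpr _ _ => Nq ls l0.
  have NqR : N%:R * (p ^ s)%:R = q%:R * d%:R + l%:R :> R by rewrite -!natrM -natrD Nq.
  have d0 : d%:R != 0 :> R := lt0r_neq0 dR_gt0.
  have ps0 : (p ^ s)%:R != 0 :> R := lt0r_neq0 (pR_gt0 s).
  have dp0 : d%:R * (p ^ s)%:R != 0 :> R by rewrite mulf_neq0.
  apply: (mulIf dp0); rewrite natrM.
  transitivity (N%:R * (p ^ s)%:R - l%:R : R); first by field; rewrite d0 ps0.
  by rewrite NqR; field.
by rewrite Nq ltn_add2l ls -{1}[(q * d)%N]addn0 ltn_add2l l0.
Qed.

Lemma crit_lambda_le N : (0 < N)%N -> crit_lambda R p n d N <= N%:R / d%:R.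
Proof.
move=> N0; have [[-> //]|[s [q [-> _ /andP[qN _] _]]]] := crit_lambda_spec N0.
by rewrite ler_pdivrMr // mulrAC ler_pdivlMr // -!natrM ler_nat ltnW.
Qed.

Lemma crit_lambda_gt0 N : (n <= N)%N -> 0 < crit_lambda R p n d N.
Proof.
move=> nN; have N0 := leq_trans n_gt0 nN.
have [[-> _]|[s [q [-> _ /andP[_ Nq] _]]]] := crit_lambda_spec N0.
  by rewrite divr_gt0 // ltr0n.
rewrite divr_gt0 // ltr0n lt0n; apply/eqP => q0; rewrite q0 mul0n add0n in Nq.
by have := p_gt0 s; move: Nq nN; clear; nia.
Qed.

Lemma crit_lambda_lt1 N : (0 < N < d)%N -> crit_lambda R p n d N < 1.
Proof.
case/andP=> N0 Nd; apply: le_lt_trans (crit_lambda_le N0) _.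
by rewrite ltr_pdivrMr // mul1r ltr_nat.
Qed.

(** Either [N / d <= c / p ^ j] already, or [N p^j] lies strictly between [d c] and [d c + n]. Then
    its residue is below [n], which forces [s <= j], and lambda [= q / p ^ s] is compared with
    [c / p ^ j] through the quotient [qj] of [N p^j]. *)
Lemma crit_lambda_le_frac N c j : (n <= N < d)%N ->
  (p ^ j * N < d * c + n)%N -> crit_lambda R p n d N <= c%:R / (p ^ j)%:R.
Proof.
case/andP=> nN Nd Nc; have N0 := leq_trans n_gt0 nN.
have [Npc|] := leqP (N * p ^ j) (d * c).
  apply: le_trans (crit_lambda_le N0) _.
  by rewrite ler_pdivrMr // mulrAC ler_pdivlMr // -!natrM ler_nat mulnC [(c * d)%N]mulnC mulnC.
move=> cNp; have [|qj [Nqj /andP[l0 ld]]] := @lpr_divn_eq (N * p ^ j).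
  by rewrite muln_gt0 N0 p_gt0.
have lj : (lpr (N * p ^ j) d < n)%N.
  have cqj : (c <= qj)%N.
    rewrite -ltnS -(ltn_pmul2r d_gt0) mulnC (leq_trans cNp) // mulSn addnC.
    by rewrite {1}Nqj leq_add2l.
  have cqjd : (d * c <= qj * d)%N by rewrite mulnC leq_mul2r cqj orbT.
  by move: Nqj Nc cqjd; rewrite mulnC; clear; lia.
(* At [j = 0] the residue is [N] itself, which is at least [n]. *)
have j0 : (0 < j)%N.
  rewrite lt0n; apply/eqP => j0; move: lj; rewrite j0 expn0 muln1 /lpr.
  by rewrite gtnNdvd // modn_small // ltnNge nN.
have [[_ /(_ j j0)]|] := crit_lambda_spec N0; first by rewrite leqNgt lj.
case=> s [q [-> s0 /andP[qN Nq] /(_ j j0 lj) sj]].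
rewrite ler_pdivrMr // mulrAC ler_pdivlMr // -!natrM ler_nat.
rewrite -(subnKC sj) expnD mulnA [(c * _)%N]mulnC [(q * _)%N]mulnC -mulnA.
rewrite leq_mul2l mulnC; apply/orP; right.
have : (q * p ^ (j - s) * d < N * p ^ j)%N.
  by rewrite -[in X in (_ < X)%N](subnKC sj) expnD mulnA mulnAC ltn_mul2r p_gt0.
rewrite Nqj => qqj; apply: (@leq_trans qj).
  rewrite -ltnS -(ltn_pmul2r d_gt0) mulSn addnC; rewrite [(_ * q)%N]mulnC; apply: leq_trans qqj _.
  by rewrite leq_add2l.
rewrite -ltnS -(ltn_pmul2r d_gt0) mulSn [(c * d)%N]mulnC.
move: Nqj Nc l0 nN Nd; rewrite mulnC => ->; lia.
Qed.

Lemma above_num_le t k : 0 <= t < 1 -> (above_num p t k <= p ^ k)%N.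
Proof.
case/andP=> t0 t1; have a_ge0 : 0 <= t * (p ^ k)%:R by rewrite mulr_ge0 // ltW.
rewrite -lez_nat /above_num gez0_abs ?ceil_ge0 ?(lt_le_trans (ltrN10 _)) //.
by rewrite ceil_le_int -pmulrn ler_piMl // ltW.
Qed.

Lemma below_threshold_ge t N : 0 <= t < 1 -> (n <= N)%N -> (d <= N)%N ->
  below_threshold t N.
Proof.
case/andP=> t0 t1 nN dN.
(* Once [above p t k < 1], each floor is at most [p ^ j - 1], which leaves room for the summand
   [n <= N]. *)
have [|k /(_ k (leqnn _))] := @above_cvg p R p_gt1 t (1 - t) t0; first by rewrite subr_gt0.
rewrite addrC subrK /above ltr_pdivrMr // mul1r ltr_nat => ak; exists k => j jk.
have : (above_num p t k %/ p ^ (k - j) < p ^ j)%N.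
  by rewrite ltn_divLR // -expnD subnKC.
move=> xp; apply: leq_trans (leq_add (leq_mul dN (leqnn _)) nN) _.
by rewrite addnC -mulnS mulnC leq_mul2r xp orbT.
Qed.

Lemma below_thresholdP t N : 0 <= t < 1 -> (n <= N < d)%N ->
  below_threshold t N <-> t < crit_lambda R p n d N.
Proof.
move=> /andP[t0 t1] /andP[nN Nd]; have N0 := leq_trans n_gt0 nN; split.
  case=> k cN; have := above_ge p_gt1 k t0; rewrite /above.
  set m := above_num p t k in cN * => /le_lt_trans; apply.
  have [[-> _]|[s [q [-> s0 /andP[qN Nq] _]]]] := crit_lambda_spec N0.
    rewrite ltr_pdivrMr // mulrAC ltr_pdivlMr // -!natrM ltr_nat.
    by have := cN k (leqnn k); rewrite subnn expn0 divn1; move: n_gt0; clear; nia.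
  rewrite ltr_pdivrMr // mulrAC ltr_pdivlMr // -!natrM ltr_nat.
  (* The bound [N p^s < q d + n] is played against the condition at [j = s] if that scale occurs,
     and otherwise against the one at [j = k] multiplied by [p ^ (s - k)]. *)
  have [sk|ks] := leqP s k.
    have cq : (m %/ p ^ (k - s) < q)%N.
      by have := cN s sk; move: Nq; clear; nia.
    have := ltn_ceil m (p_gt0 (k - s)); rewrite -(ltn_pmul2r (p_gt0 s)) -mulnA -expnD subnK //.
    by move=> /leq_trans; apply; rewrite leq_mul2r cq orbT.
  have := cN k (leqnn k); rewrite subnn expn0 divn1 => cNk.
  have psE : (p ^ s = p ^ k * p ^ (s - k))%N by rewrite -expnD subnKC // ltnW.
  rewrite psE mulnCA mulnC ltn_pmul2r //.
  have : (d * m * p ^ (s - k) + n <= N * p ^ s)%N.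
    rewrite psE mulnA [(N * _)%N]mulnC.
    apply: leq_trans (leq_mul cNk (leqnn (p ^ (s - k)))).
    by rewrite mulnDl leq_add2l leq_pmulr.
  by move: Nq; clear; nia.
(* Take [k] with [above p t k] below lambda; a failure at scale [j] would bound lambda by a
   truncation of [above p t k]. *)
move=> tL; have [|k /(_ k (leqnn _))] :=
  @above_cvg p R p_gt1 t (crit_lambda R p n d N - t) t0; first by rewrite subr_gt0.
rewrite addrC subrK => aL; exists k => j jk; rewrite leqNgt; apply/negP => /crit_lambda_le_frac.
rewrite nN Nd => /(_ isT); apply/negP; rewrite -ltNge; apply: le_lt_trans aL.
rewrite /above ler_pdivrMr // mulrAC ler_pdivlMr // -!natrM ler_nat.
have -> : (p ^ k = p ^ (k - j) * p ^ j)%N by rewrite -expnD subnK.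
by rewrite mulnA leq_mul2r leq_divM orbT.
Qed.

(** In fact [N / d] is already below the larger value: truncation costs [k p^s - q d < n], while
    [(k - N) p^s >= p > d > n]. *)
Lemma crit_lambda_mono N k : (d < p)%N -> (n <= N)%N -> (N < k < d)%N ->
  crit_lambda R p n d N < crit_lambda R p n d k.
Proof.
move=> dp nN /andP[Nk kd]; have N0 := leq_trans n_gt0 nN.
have k0 := ltn_trans N0 Nk.
apply: le_lt_trans (crit_lambda_le N0) _.
have [[-> _]|[s [q [-> s0 /andP[qN kq] _]]]] := crit_lambda_spec k0.
  by rewrite ltr_pM2r ?invr_gt0 // ltr_nat.
rewrite ltr_pdivrMr // mulrAC ltr_pdivlMr // -!natrM ltr_nat.
have : (p <= p ^ s)%N by rewrite -{1}(expn1 p) leq_exp2l.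
by move: Nk kd nN dp kq; clear; nia.
Qed.

End RealThreshold.

(** * Real Frobenius powers with exponent below 1 *)

Section FrobReal.
Variables (R : realType) (p : nat) (K : fieldType) (n d : nat).
Hypothesis charK : p \in [pchar K].
Hypothesis finK : F_finite p K.
Hypothesis n_gt0 : (0 < n)%N.
Hypothesis d_gt0 : (0 < d)%N.

Lemma frob_real_max_ideal (t : R) : 0 <= t < 1 ->
  frob_real p (ideal_exp (max_ideal K n) d) t =
  mon_ideal K [set w : 'X_{1..n} | (d <= mdeg w + n)%N \/
                   t < crit_lambda R p n d (mdeg w + n)].
Proof.
move=> t01; have p1 : (1 < p)%N := prime_gt1 (pcharf_prime charK).
have -> : ideal_exp (max_ideal K n) d = mon_ideal K [set w : 'X_{1..n} | (d <= mdeg w)%N].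
  by rewrite max_idealE mon_ideal_deg_exp mul1n.
have thr (w : 'X_{1..n}) : below_threshold p n d t (mdeg w + n) <->
    (d <= mdeg w + n)%N \/ t < crit_lambda R p n d (mdeg w + n).
  have [dw|wd] := leqP d (mdeg w + n).
    by split=> [_|_]; [left|apply: below_threshold_ge; rewrite ?leq_addl].
  rewrite below_thresholdP ?leq_addl //; split=> [|[]//]; by right.
apply/seteqP; split=> [f [k _]|f If].
  rewrite mon_ideal_frob_frac ?above_num_le // => If w fw.
  by apply/thr; exists k; apply: If.
have [/eqP f0|] := boolP (msupp f == [::]).
  by exists 0%N => //; rewrite mon_ideal_frob_frac ?above_num_le // => w; rewrite f0.
case fE : (msupp f) => [//|w0 r] _.
(* One [k] must serve all monomials of [f]. The conditions only get weaker as the degree grows, so a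
   monomial of least degree provides it. *)
have exm : exists m, has (fun w => mdeg w == m) (msupp f).
  by exists (mdeg w0); rewrite fE /= eqxx.
case: (ex_minnP exm) => m /hasP[w fw /eqP wm] m_min.
have /thr[k ck] := If w fw; exists k => //.
rewrite mon_ideal_frob_frac ?above_num_le // => v fv j jk.
apply: leq_trans (ck j jk) _; rewrite leq_mul2l leq_add2r wm m_min ?orbT //.
by apply/hasP; exists v.
Qed.

End FrobReal.

(** * Critical exponents of powers of the maximal ideal *)

Theorem theorem1 (R : realType) (p : nat) (K : fieldType) (n d : nat)
    (charK : p \in [pchar K]) (finK : F_finite p K)
    (n_gt0 : (0 < n)%N) (d_gt0 : (0 < d)%N) :
  [/\ forall k : nat, (n <= k < d)%N ->
        critical_exponent p (ideal_exp (max_ideal K n) d)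
          (crit_lambda R p n d k),
      forall l : R, 0 < l < 1 ->
        critical_exponent p (ideal_exp (max_ideal K n) d) l ->
        exists2 k : nat, (n <= k < d)%N & l = crit_lambda R p n d k
    & (d < p)%N -> forall k : nat, (n <= k < d)%N ->
        frob_real p (ideal_exp (max_ideal K n) d) (crit_lambda R p n d k) =
        ideal_exp (max_ideal K n) (k - n + 1)%N ].
Proof.
have p1 : (1 < p)%N := prime_gt1 (pcharf_prime charK).
have realE := frob_real_max_ideal charK finK n_gt0 d_gt0.
pose i0 : 'I_n := Ordinal n_gt0.
(* A monomial of degree [k - n], whose threshold is the lambda of [k]: it witnesses the drop
   there. *)
pose wk k : 'X_{1..n} := (U_(i0) *+ (k - n))%MM.
have degwk k : (n <= k)%N -> (mdeg (wk k) + n = k)%N.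
  by move=> nk; rewrite mdegMn mdeg1 mul1n subnK.
have lambda01 k : (n <= k < d)%N -> 0 <= crit_lambda R p n d k < 1.
  case/andP=> nk kd; rewrite ltW ?crit_lambda_gt0 // crit_lambda_lt1 //.
  by rewrite (leq_trans n_gt0 nk).
split=> [k kd|l /andP[l0 l1] [_ crit]|dp k kd].
- have /andP[_ L1] := lambda01 k kd; have [nk lt_kd] := andP kd.
  split=> [|e e0 eL]; first exact: crit_lambda_gt0.
  rewrite !realE ?lambda01 //; last first.
    by rewrite subr_ge0 eL (lt_trans _ L1) // gtrBl.
  split=> [|sub].
    move=> f If w /If[]; [by left|move=> Lw; right; apply: lt_trans Lw].
    by rewrite gtrBl.
  have /sub /mon_idealX[] : mon_ideal K [set w : 'X_{1..n} | (d <= mdeg w + n)%N \/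
      crit_lambda R p n d k - e < crit_lambda R p n d (mdeg w + n)] 'X_[wk k].
  + by apply/mon_idealX; right; rewrite degwk // gtrBl.
  + by rewrite degwk // leqNgt lt_kd.
  + by rewrite degwk // ltxx.
- apply: contrapT => nok.
  have Lneq k : (n <= k < d)%N -> crit_lambda R p n d k != l.
    by move=> kd; apply/eqP => Ll; apply: nok; exists k.
  pose below (k : 'I_d) := (n <= k)%N && (crit_lambda R p n d k < l).
  (* The least gap from [l] down to the finitely many thresholds below it, capped by [l]. As [l] is
     not a threshold, none lies in [(l - e, l]], so the two ideals agree. *)
  pose e := \big[Num.min/l]_(k < d | below k) (l - crit_lambda R p n d k).
  have e0 : 0 < e.
    by apply: lt_bigmin => // k /andP[_]; rewrite subr_gt0.
  have el : e <= l by apply: bigmin_le_id.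
  have l01 : 0 <= l < 1 by rewrite ltW.
  have le01 : 0 <= l - e < 1 by rewrite subr_ge0 el (lt_trans _ l1) // gtrBl.
  have [_] := crit e e0 el; apply; rewrite !realE //.
  move=> f If w /If[dw|Lw]; [by left|].
  have [dw|wd] := leqP d (mdeg w + n); [by left|right].
  have nw : (n <= mdeg w + n)%N by rewrite leq_addl.
  rewrite lt_neqAle eq_sym Lneq ?nw //= leNgt; apply/negP => Ll.
  suff : e <= l - crit_lambda R p n d (mdeg w + n) by rewrite lerBrDl -lerBrDr leNgt Lw.
  by apply: (@bigmin_le_cond _ _ _ _ (Ordinal wd)); rewrite /below /= nw.
- have /andP[nk lt_kd] := kd.
  rewrite realE ?lambda01 // max_idealE mon_ideal_deg_exp mul1n.
  (* Thresholds increase strictly with the degree when [p > d], so exceeding the lambda of [k] means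
     [mdeg w + n > k]. *)
  apply: mon_ideal_eq => w /=; split=> [[dw|Lw]|kw].
  + by move: dw lt_kd nk; clear; lia.
  + rewrite leqNgt; apply/negP => wk'; move: Lw; apply/negP; rewrite -leNgt.
    have : (mdeg w + n <= k)%N by move: wk' nk; clear; lia.
    rewrite leq_eqVlt => /predU1P[-> //|wk2].
    by rewrite ltW // crit_lambda_mono // ?leq_addl // wk2.
  + have [dw|wd] := leqP d (mdeg w + n); [by left|right].
    by rewrite crit_lambda_mono // wd andbT; move: kw nk; clear; lia.
Qed.
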